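(* For every B&V-QTM $M=\langle\Sigma,Q,\delta,q_0,q_f\rangle$ (as in the context) there is a QTM $M'$ (as in the context) such that for every initial configuration $C$ of $M$: if $M$ on input $|C\rangle$ halts in $k$ steps in the final q-configuration $|\phi\rangle=U_M^k|C\rangle$, then $U_{M'}^k|C\rangle=|\phi\rangle$.
   Context: Let $\Sigma$ be a finite alphabet containing $1$ and the blank $\Box$; $\mathbb D=\{L,R\}$; $\ell^2(I)$ is the Hilbert space of square-summable complex functions on a countable set $I$, $|c\rangle$ the indicator of $c$. Step function on triples: $\gamma(\langle\alpha w,q,u\beta\rangle,p,v,R)=\langle\alpha wv,p,\beta\rangle$, $\gamma(\langle\alpha w,q,u\beta\rangle,p,v,L)=\langle\alpha,p,wv\beta\rangle$ (triples taken up to adding blanks at the left of $\alpha$ or at the right of $\beta$; the head scans the first symbol of $\beta$). B&V-QTM (well-formed, stationary, normal-form QTM of Bernstein and Vazirani): a tuple $M=\langle\Sigma,Q,\delta,q_0,q_f\rangle$ with $Q$ finite, $q_0\ne q_f\in Q$, $\delta:Q\times\Sigma\to\ell^2(Q\times\Sigma\times\mathbb D)$ satisfying the local unitary conditions (for all $(q,a)$, $\sum_{(p,b,d)}|\delta(q,a)(p,b,d)|^2=1$; for $(q,a)\ne(q',a')$, $\sum_{(p,b,d)}\overline{\delta(q',a')(p,b,d)}\delta(q,a)(p,b,d)=0$; for all $(q,a,b),(q',a',b')$, $\sum_{p\in Q}\overline{\delta(q',a')(p,b',L)}\delta(q,a)(p,b,R)=0$), and such that $\delta(q_f,a)(q_0,a,R)=1$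 for all $a\in\Sigma$, hence $\delta(q_f,a)(q',a',d)=0$ for $(q',a',d)\ne(q_0,a,R)$ and $\delta(q',a')(q_0,a,d)=0$ for $(q',a',d)\ne(q_f,a,R)$. Its configurations are all triples in $\Sigma^*\times Q\times\Sigma^*$ (up to blank padding); its time evolution $U_M$ is the bounded extension of $|\langle\alpha,q,u\beta\rangle\rangle\mapsto\sum_{(p,v,d)}\delta(q,u)(p,v,d)|\gamma(\langle\alpha,q,u\beta\rangle,p,v,d)\rangle$. Initial (final) configurations are those with state $q_0$ ($q_f$). For an initial configuration $C$, let $k=\min\{j: U_M^j|C\rangle$ has a final configuration with nonzero amplitude$\}$; B&V-QTMs are required to satisfy: if such $k$ exists then all configurations with nonzero amplitude in $U_M^k|C\rangle$ are final (and the head is on the start cell); in that case $M$ halts in $k$ steps on $|C\rangle$, in the final q-configuration $U_M^k|C\rangle$. QTM: a tuple $M'=\langle\Sigma,Q,Q_s,Q_t,\delta',q_i,q_f\rangle$ with disjoint $Q_s\ni q_i$, $Q_t\ni q_f$, $Q_0=Q\setminus(Q_s\cup Q_t)$, extra symbols $\bar a$ ($a\in\Sigma$), $\bar\Sigma=\{\bar a\}$, $\tilde\Sigma=\Sigma\cup\bar\Sigma$; with $S_0=(Q_0\cup Q_s)\times\Sigma$, $S_s=Q_s\times\bar\Sigma$, $S_t=Q_t\times\Sigma$, $T_0=(Q_0\cup Q_t)\times\Sigma$, $T_s=Q_s\times\Sigma$, $T_t=Q_t\times\bar\Sigma$, $\delta'=\delta_0\cup\delta_s\cup\delta_t$, $\delta_x:S_x\to\ell^2(T_x\times\mathbb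 D)$, $\delta_s(q,\bar a)$ the indicator of $(q,a,R)$, $\delta_t(q,a)$ the indicator of $(q,\bar a,R)$, and $\delta_0$ satisfying the local unitary conditions with $(q,a)$ ranging over $S_0$, $(p,b,d)$ over $T_0\times\mathbb D$, and in the third condition $p$ over $Q_0\cup Q_t$. Its configurations are triples $\langle\alpha,q,\beta\rangle\in\tilde\Sigma^*\times Q\times\tilde\Sigma^*$ (up to blank padding) with $q\in Q_0\Rightarrow\alpha\beta\in\Sigma^*$, $q\in Q_s\Rightarrow\alpha\in\Sigma^*,\beta\in\bar\Sigma^*\Sigma^*$, $q\in Q_t\Rightarrow\beta\in\Sigma^*,\alpha\in\Sigma^*\bar\Sigma^*$; its time evolution $U_{M'}$ is the bounded extension of $|\langle\alpha,q,u\beta\rangle\rangle\mapsto\sum_{(p,v,d)\in T_x\times\mathbb D}\delta_x(q,u)(p,v,d)|\gamma(\cdot,p,v,d)\rangle$ for $(q,u)\in S_x$. Configurations of $M$ in which the state is $q_0$ or $q_f$ are also configurations of $M'$ when $q_0\in Q_s$, $q_f\in Q_t$. *)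

(* Defs.v *)
From HB Require Import structures.
From mathcomp Require Import all_boot all_order all_algebra.
From mathcomp Require Import all_classical all_reals ereal esum.
From mathcomp Require Import ring lra.
From mathcomp.real_closed Require Import complex.

Set Implicit Arguments.
Unset Strict Implicit.
Unset Printing Implicit Defensive.

Import Order.TTheory GRing.Theory Num.Theory.

Local Open Scope classical_set_scope.
Local Open Scope ring_scope.

Section Ell2Def.
Variables (R : realType) (I : choiceType).
Implicit Types (f g : I -> R[i]^o).

Definition sqmod (z : R[i]) : R := complex.Re `|z| ^+ 2.

Definition energy f : \bar R := \esum_(i in [set: I]) (sqmod (f i))%:E.

Definition sq_summable : {pred I -> R[i]^o} :=
  mem [set f | (energy f < +oo)%E].

Lemma sqmodE z : sqmod z = complex.Re z ^+ 2 + complex.Im z ^+ 2.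
Proof.
by rewrite /sqmod normc_def /= sqr_sqrtr // addr_ge0 // sqr_ge0.
Qed.

Lemma sqmod_ge0 z : 0 <= sqmod z. Proof. exact: sqr_ge0. Qed.

Lemma sqmodM z w : sqmod (z * w) = sqmod z * sqmod w.
Proof. by rewrite !sqmodE; case: z w => [a b] [c d] /=; ring. Qed.

Lemma sqmodD z w : sqmod (z + w) <= 2 * sqmod z + 2 * sqmod w.
Proof. 
rewrite !sqmodE; case: z w => [a b] [c d] /=. 
have := sqr_ge0 (a - c); have := sqr_ge0 (b - d); rewrite !expr2; lra. 
Qed.

Lemma sqmod0 : sqmod 0 = 0.
Proof. by rewrite sqmodE /= expr0n addr0. Qed.

Lemma energy_ge0 f : (0 <= energy f)%E.
Proof. by apply: esum_ge0 => i _; rewrite lee_fin sqmod_ge0. Qed.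

Lemma energy0 : energy 0 = 0%E.
Proof. by apply: esum1 => i _; rewrite sqmod0. Qed.

Lemma energyZ_le a f : (energy (a *: f)%R <= (sqmod a)%:E * energy f)%E.
Proof.
apply: ub_ereal_sup => _ [A [finA _]] <-.
have -> : (\sum_(i \in A) (sqmod ((a *: f) i))%:E
   = (sqmod a)%:E * \sum_(i \in A) (sqmod (f i))%:E)%E.
  rewrite ge0_mule_fsumr; first by apply: eq_fsbigr => i _; rewrite -EFinM -sqmodM.
  by move=> i; rewrite lee_fin sqmod_ge0.
apply: lee_wpmul2l; first by rewrite lee_fin sqmod_ge0.
by apply: ereal_sup_ubound; exists A.
Qed.

Lemma energyD_le f g : (energy (f + g)%R <= 2%:E * energy f + 2%:E * energy g)%E.
Proof.
apply: ub_ereal_sup => _ [A [finA _]] <-.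
apply: (@le_trans _ _ (\sum_(i \in A)
   (2%:E * (sqmod (f i))%:E + 2%:E * (sqmod (g i))%:E))%E).
  apply: lee_fsum => // i _.
  by rewrite -!EFinM -EFinD lee_fin sqmodD.
rewrite fsbig_split//= -!ge0_mule_fsumr; try by move=> i; rewrite lee_fin sqmod_ge0.
apply: leeD; apply: lee_wpmul2l => //; apply: ereal_sup_ubound; by exists A.
Qed.

Lemma sq_summable_submod : submod_closed sq_summable.
Proof.
split; first by rewrite inE /= energy0 ltry.
move=> a f g; rewrite !inE /= => fi gi.
apply: le_lt_trans (energyD_le _ _) _.
apply: lte_add_pinfty; apply: lte_mul_pinfty => //.
apply: le_lt_trans (energyZ_le _ _) _; apply: lte_mul_pinfty => //.
by rewrite lee_fin sqmod_ge0.
Qed.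

HB.instance Definition _ :=
  GRing.isSubmodClosed.Build R[i] (I -> R[i]^o) sq_summable sq_summable_submod.

Record ell2 := Ell2 { ell2_fun :> I -> R[i]^o; _ : ell2_fun \in sq_summable }.

HB.instance Definition _ := [isSub for ell2_fun].
HB.instance Definition _ := [Choice of ell2 by <:].
HB.instance Definition _ := [SubChoice_isSubLmodule of ell2 by <:].

End Ell2Def.

Section Ket.
Variables (R : realType) (I : choiceType).

Lemma ket_subproof (i : I) :
  (fun j => (j == i)%:R : R[i]^o) \in @sq_summable R I.
Proof.
rewrite inE /= /energy (_ : (\esum_(j in _) _)%E =
  (\esum_(j in [set i]) (sqmod (1 : R[i]))%:E)%E).
  by rewrite esum_set1 ?ltry // lee_fin sqmod_ge0.
rewrite [RHS]esum_mkcond; apply: eq_esum => j _.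
rewrite (_ : (j \in [set i]) = (j == i)); last first.
  by apply/idP/eqP => [|->]; rewrite inE.
by case: eqP; rewrite ?sqmod0.
Qed.

Definition ket (i : I) : ell2 R I := Ell2 (ket_subproof i).

Definition l2norm (psi : ell2 R I) : R := Num.sqrt (fine (energy psi)).

Definition bounded_extension (f : I -> ell2 R I) (U : ell2 R I -> ell2 R I) :=
  [/\ linear U,
      exists K : R, forall psi, l2norm (U psi) <= K * l2norm psi
    & forall i, U (ket i) = f i].

(* The bounded linear operator sending each basis vector [ket i] to [f i];
   the identity if there is none, which does not happen for the machines
   below, see [bv_evolP], [bv_pos_evolP] and [qtm_evolP]. *)
Definition evolution (f : I -> ell2 R I) : ell2 R I -> ell2 R I :=
  if pselect (exists U, bounded_extension f U) is left ex
  then projT1 (cid ex) else id.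

Lemma evolutionP f : (exists U, bounded_extension f U) ->
  bounded_extension f (evolution f).
Proof. by rewrite /evolution; case: pselect => // ex _; case: (cid ex). Qed.

End Ket.

Section Push.
Variables (R : realType) (I J : choiceType) (g : I -> option J).

Definition partial_inverse (j : J) : option I :=
  if pselect (exists i, g i = Some j) is left ex
  then Some (projT1 (cid ex)) else None.

Lemma partial_inverseP j i : partial_inverse j = Some i -> g i = Some j.
Proof.
by rewrite /partial_inverse; case: pselect => // ex [<-]; case: (cid ex).
Qed.

Lemma partial_inverse_inj (i : I) (j : J) :
  (forall i', g i' = Some j -> i' = i) ->
  partial_inverse j = Some i <-> g i = Some j.
Proof.
move=> inj; split; first exact: partial_inverseP.
rewrite /partial_inverse; case: pselect => [ex|nex gi].
  by case: (cid ex) => i' /= /inj ->.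
by case: nex; exists i.
Qed.

Definition push_fun (psi : ell2 R I) : J -> R[i]^o :=
  fun j => oapp psi 0 (partial_inverse j).

Lemma energy_push (psi : ell2 R I) :
  (energy (push_fun psi) <= energy psi)%E.
Proof.
set D := [set j | partial_inverse j].
rewrite /energy (_ : (\esum_(j in _) _)%E = (\esum_(j in D)
    (sqmod (push_fun psi j))%:E)%E); last first.
  rewrite [RHS]esum_mkcond; apply: eq_esum => j _.
  rewrite /push_fun mem_setE /D /in_mem /=; case: (partial_inverse j) => //=.
  by rewrite sqmod0.
apply: ub_ereal_sup => _ [A [finA AD]] <-.
have [->|/set0P[j0 Aj0]] := eqVneq A set0.
  by rewrite fsbig_set0 energy_ge0.
have [i0 _] : exists i0, partial_inverse j0 = Some i0.
  by have := AD _ Aj0; rewrite /D /=; case: (partial_inverse j0) => // i0; exists i0.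
pose h j := odflt i0 (partial_inverse j).
have hE j : A j -> partial_inverse j = Some (h j).
  by move=> /AD; rewrite /D /= /h; case: (partial_inverse j).
have injh : {in A &, injective h}.
  move=> j j'; rewrite !inE => Aj Aj' e.
  have := partial_inverseP (hE _ Aj); rewrite e.
  by rewrite (partial_inverseP (hE _ Aj')) => -[].
have -> : (\sum_(j \in A) (sqmod (push_fun psi j))%:E
   = \sum_(i \in h @` A) (sqmod (psi i))%:E)%E.
  rewrite (fsbig_image _ _ _ injh); apply: eq_fsbigr => j; rewrite inE => Aj.
  by rewrite /= /push_fun hE.
by apply: ereal_sup_ubound; exists (h @` A) => //; split => //; exact: finite_image.
Qed.

Lemma push_subproof (psi : ell2 R I) :
  push_fun psi \in @sq_summable R J.
Proof.
rewrite inE /=; apply: le_lt_trans (energy_push psi) _.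
by case: psi => f /=; rewrite inE.
Qed.

(* For g injective where defined, the operator with |i> |-> |j> if
   [g i = Some j] and |i> |-> 0 if [g i = None]; see [push_ket]. *)
Definition push (psi : ell2 R I) : ell2 R J := Ell2 (push_subproof psi).

Lemma push_linear : linear push.
Proof.
move=> a psi phi; apply: val_inj; apply: funext => j /=; rewrite /push_fun.
rewrite ![in RHS]/GRing.add ![in RHS]/GRing.scale /=.
by case: (partial_inverse j) => //=; rewrite ?scaler0 ?addr0.
Qed.

Lemma push_ket : (forall i i' j, g i = Some j -> g i' = Some j -> i = i') ->
  forall i, push (ket R i) = oapp (@ket R J) 0 (g i).
Proof.
move=> inj i; apply: val_inj; apply: funext => j /=; rewrite /push_fun.
case gi: (g i) => [j'|] /=; last first.
  case hj: (partial_inverse j) => [i'|] //=.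
  case: eqP => // ii'; move/partial_inverseP: hj; by rewrite ii' gi.
case: eqP => [->|jj'].
  rewrite (proj2 (partial_inverse_inj _) gi) /= ?eqxx // => i' gi'.
  exact: inj gi' gi.
case hj: (partial_inverse j) => [i'|] //=; case: eqP => // ii'.
by move/partial_inverseP: hj; rewrite ii' gi => -[] /esym.
Qed.

End Push.

Section Existence.
Variables (R : realType) (I : choiceType).
Implicit Types (U : ell2 R I -> ell2 R I).

Let ebounded U :=
  exists2 K : R, 0 <= K & forall psi, (energy (U psi) <= K%:E * energy psi)%E.

Lemma ebounded_l2norm U : ebounded U ->
  exists K : R, forall psi, l2norm (U psi) <= K * l2norm psi.
Proof.
move=> [K K0 HU]; exists (Num.sqrt K) => psi.
have fin (phi : ell2 R I) : energy phi \is a fin_num.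
  by rewrite ge0_fin_numE ?energy_ge0 //; case: phi => f /=; rewrite inE.
rewrite /l2norm -sqrtrM // ler_wsqrtr //.
by rewrite -lee_fin EFinM !fineK.
Qed.

Lemma ex_bounded_extension (Y : finType) (g : Y -> I -> option I)
    (a : Y -> R[i]) (f : I -> ell2 R I) :
  (forall y i i' j, g y i = Some j -> g y i' = Some j -> i = i') ->
  (forall i, f i = \sum_y a y *: oapp (@ket R I) 0 (g y i)) ->
  exists U, bounded_extension f U.
Proof.
move=> inj fE; exists (fun psi => \sum_y a y *: push (g y) psi); split.
- move=> b psi phi; rewrite scaler_sumr -big_split /=; apply: eq_bigr => y _.
  by rewrite push_linear scalerDr !scalerA mulrC.
- apply: ebounded_l2norm.
  elim: (index_enum Y) => [|y s [K K0 IH]].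
    exists 0 => // psi; rewrite big_nil mul0e.
    by rewrite (_ : ell2_fun 0 = 0) // energy0.
  exists (2 * sqmod (a y) + 2 * K).
    by rewrite addr_ge0 // mulr_ge0 // sqmod_ge0.
  move=> psi; rewrite big_cons; apply: le_trans (energyD_le _ _) _.
  rewrite [(2 * sqmod _ + 2 * K)%:E]EFinD [leRHS]ge0_muleDl;
    try by rewrite lee_fin mulr_ge0 ?sqmod_ge0.
  rewrite [(2 * sqmod _)%:E]EFinM [(2 * K)%:E]EFinM -!muleA.
  apply: leeD; apply: lee_wpmul2l => //; last exact: IH.
  apply: le_trans (energyZ_le _ _) _; apply: lee_wpmul2l.
    by rewrite lee_fin sqmod_ge0.
  exact: energy_push.
- by move=> i; rewrite fE; apply: eq_bigr => y _; rewrite push_ket //; exact: inj.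
Qed.

End Existence.

Variant dir := DL | DR.

Definition bool_of_dir d := if d is DR then true else false.
Definition dir_of_bool b := if b then DR else DL.
Lemma bool_of_dirK : cancel bool_of_dir dir_of_bool. Proof. by case. Qed.
HB.instance Definition _ := Finite.copy dir (can_type bool_of_dirK).

Section Config.
Variables (A : finType) (blank : A) (Q : finType).

Definition rstrip : seq A -> seq A :=
  foldr (fun a s => if (a == blank) && nilp s then [::] else a :: s) [::].
Definition lstrip (s : seq A) : seq A := rev (rstrip (rev s)).

Local Notation triple := (seq A * Q * seq A)%type.

Definition strip (t : triple) : triple := (lstrip t.1.1, t.1.2, rstrip t.2).

(* A class of triples up to blank padding is represented by its only member
   <alpha, q, beta> such that alpha has no leading blank and beta no trailing
   blank; [mkconf] is the projection onto classes, see [mkconf_eqP]. *)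
Record conf := Conf { conf_triple :> triple; _ : strip conf_triple == conf_triple }.

HB.instance Definition _ := [isSub for conf_triple].
HB.instance Definition _ := [Countable of conf by <:].

Lemma nth_rstrip s n : nth blank (rstrip s) n = nth blank s n.
Proof.
elim: s n => [|a s IH] n //=; case: ifP => [/andP[/eqP -> /nilP e]|_].
  by case: n => [|n] //=; rewrite -IH e nth_nil.
by case: n => [|n] //=.
Qed.

Lemma rstrip_eqP s t : rstrip s = rstrip t <-> nth blank s =1 nth blank t.
Proof.
split=> [e n|]; first by rewrite -nth_rstrip e nth_rstrip.
have nilE u : (forall n, nth blank u n = blank) -> rstrip u = [::].
  elim: u => //= a u IH un; rewrite IH ?andbT => [|n]; last exact: (un n.+1).
  by rewrite [a](un 0%N) eqxx.
elim: s t => [|a s IH] [|b t] e //.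
- by rewrite [RHS]nilE // => n; rewrite -e nth_nil.
- by rewrite [LHS]nilE // => n; rewrite e nth_nil.
- by rewrite /= (IH t) => [|n]; [rewrite [a](e 0%N)|exact: (e n.+1)].
Qed.

Lemma rstrip_idem s : rstrip (rstrip s) = rstrip s.
Proof. by apply/rstrip_eqP => n; exact: nth_rstrip. Qed.

Lemma lstrip_eqP s t :
  lstrip s = lstrip t <-> nth blank (rev s) =1 nth blank (rev t).
Proof.
by rewrite -rstrip_eqP /lstrip; split=> [/(can_inj revK)|->].
Qed.

Lemma lstrip_idem s : lstrip (lstrip s) = lstrip s.
Proof. by rewrite /lstrip revK rstrip_idem. Qed.

Lemma strip_idem t : strip (strip t) == strip t.
Proof. by rewrite /strip /= lstrip_idem rstrip_idem. Qed.

Definition mkconf (t : triple) : conf := Conf (strip_idem t).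

Lemma mkconfE t t' : mkconf t = mkconf t' <->
  [/\ nth blank (rev t.1.1) =1 nth blank (rev t'.1.1), t.1.2 = t'.1.2
    & nth blank t.2 =1 nth blank t'.2].
Proof.
split=> [/(congr1 conf_triple) [/lstrip_eqP ? ? /rstrip_eqP ?] //|].
move=> [/lstrip_eqP e1 e2 /rstrip_eqP e3]; apply: val_inj.
by rewrite /= /strip e1 e2 e3.
Qed.

Lemma conf_tripleK (c : conf) : mkconf c = c.
Proof. by apply: val_inj; case: c => t /= /eqP. Qed.

Lemma rstrip_pad s : exists n, s = rstrip s ++ nseq n blank.
Proof.
elim: s => [|a s [n e]] /=; first by exists 0%N.
case: ifP => [/andP[/eqP -> /nilP e']|_]; last by exists n; rewrite {1}e.
by exists n.+1; rewrite {1}e e'.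
Qed.

Lemma mkconf_eqP (t t' : triple) : mkconf t = mkconf t' <->
  [/\ exists i j, nseq i blank ++ t.1.1 = nseq j blank ++ t'.1.1,
      t.1.2 = t'.1.2
    & exists i j, t.2 ++ nseq i blank = t'.2 ++ nseq j blank].
Proof.
have padP s s' : nth blank s =1 nth blank s' <->
    exists i j, s ++ nseq i blank = s' ++ nseq j blank.
  split=> [/rstrip_eqP e|[i [j e]]] => [|n].
    have [i ei] := rstrip_pad s; have [j ej] := rstrip_pad s'.
    by exists j, i; rewrite ei ej e -!catA -!nseqD addnC.
  have padE u k : nth blank u n = nth blank (u ++ nseq k blank) n.
    rewrite nth_cat nth_nseq if_same; case: ltnP => // nu.
    by rewrite nth_default.
  by rewrite (padE _ i) e -padE.
have revn n : rev (nseq n blank) = nseq n blank.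
  by elim: n => // n IH; rewrite -addn1 nseqD rev_cat IH -nseqD addnC.
rewrite mkconfE; split=> -[e1 e2 e3]; split=> //; try exact/padP.
  have [i [j /(congr1 rev)]] := (padP _ _).1 e1.
  by rewrite !rev_cat !revK !revn => e; exists i, j.
case: e1 => i [j /(congr1 rev)]; rewrite !rev_cat !revn => e.
by apply/padP; exists i, j.
Qed.

Definition state (c : conf) : Q := c.1.2.
Definition scanned (c : conf) : A := head blank c.2.

Definition gamma (t : triple) (x : Q * A * dir) : triple :=
  let: (alpha, _, beta) := t in
  let: (p, v, d) := x in
  match d with
  | DR => (rcons alpha v, p, behead beta)
  | DL => (take (size alpha).-1 alpha, p, [:: last blank alpha, v & behead beta])
  end.

Lemma gammaR alpha w q u beta p v :
  gamma (rcons alpha w, q, u :: beta) (p, v, DR)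
  = (rcons (rcons alpha w) v, p, beta).
Proof. by []. Qed.

Lemma gammaL alpha w q u beta p v :
  gamma (rcons alpha w, q, u :: beta) (p, v, DL) = (alpha, p, [:: w, v & beta]).
Proof. by rewrite /= size_rcons last_rcons -cats1 take_size_cat. Qed.

Definition conf_step (c : conf) (x : Q * A * dir) : conf := mkconf (gamma c x).

Lemma gamma_eqP t t' x : head blank t.2 = head blank t'.2 -> t.1.2 = t'.1.2 ->
  mkconf (gamma t x) = mkconf (gamma t' x) <-> mkconf t = mkconf t'.
Proof.
have revtake (s : seq A) : rev (take (size s).-1 s) = behead (rev s).
  by case/lastP: s => // s a; rewrite size_rcons rev_rcons -cats1 take_size_cat.
have lastrev (s : seq A) : last blank s = head blank (rev s).
  by case/lastP: s => // s a; rewrite last_rcons rev_rcons.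
case: t t' x => [[al q] be] [[al' q'] be'] [[p v] [|]] /= ehd eq.
- rewrite !mkconfE /= !revtake !lastrev -!nth0; split=> -[e1 _ e2]; split=> //.
  + move=> [|n]; first exact: (e2 0%N).
    by have := e1 n; rewrite !nth_behead.
  + by move=> [|n]; [rewrite !nth0|have := e2 n.+2; rewrite /= !nth_behead].
  + by move=> n; rewrite !nth_behead.
  + by move=> [|[|n]] //=; rewrite ?e1 // !nth_behead.
- rewrite !mkconfE /= !rev_rcons; split=> -[e1 _ e2]; split=> //.
  + by move=> n; exact: (e1 n.+1).
  + by move=> [|n]; [rewrite !nth0|have := e2 n; rewrite !nth_behead].
  + by move=> [|n] //=.
  + by move=> n; rewrite !nth_behead.
Qed.

Lemma conf_step_mkconf t x : conf_step (mkconf t) x = mkconf (gamma t x).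
Proof.
by apply/gamma_eqP; rewrite ?conf_tripleK // -!nth0 nth_rstrip.
Qed.

Lemma conf_step_inj c c' x : state c = state c' -> scanned c = scanned c' ->
  conf_step c x = conf_step c' x -> c = c'.
Proof. by move=> ec es /gamma_eqP; rewrite !conf_tripleK; apply. Qed.

End Config.

Section LocalUnitarity.
Variables (R : realType) (A Q : finType).

(* The sources (q, a) range over S, the targets (p, b, d) over P x B x {L, R}. *)
Definition local_unitary (S : {pred Q * A}) (P : {pred Q}) (B : {pred A})
    (delta : Q * A -> Q * A * dir -> R[i]) : Prop :=
  [/\ forall s, s \in S ->
        \sum_(x : Q * A * dir | (x.1.1 \in P) && (x.1.2 \in B))
          `|delta s x| ^+ 2 = 1,
      forall s s', s \in S -> s' \in S -> s != s' ->
        \sum_(x : Q * A * dir | (x.1.1 \in P) && (x.1.2 \in B))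
          (delta s' x)^* * delta s x = 0
    & forall s s' b b', s \in S -> s' \in S -> b \in B -> b' \in B ->
        \sum_(p in P) (delta s' (p, b', DL))^* * delta s (p, b, DR) = 0].

End LocalUnitarity.

Section BV.
Variables (R : realType) (Sigma : finType) (blank : Sigma) (Q : finType).

Record bv_data := BVData {
  bv_delta : Q * Sigma -> Q * Sigma * dir -> R[i];
  bv_q0 : Q;
  bv_qf : Q }.

Variable M : bv_data.
Local Notation conf := (conf blank Q).

Definition bv_step (c : conf) : ell2 R conf :=
  \sum_x bv_delta M (state c, scanned c) x *: ket R (conf_step c x).

Definition bv_evol : ell2 R conf -> ell2 R conf := evolution bv_step.

Definition bv_initial (c : conf) : Prop := state c = bv_q0 M.
Definition bv_final (c : conf) : Prop := state c = bv_qf M.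

Definition shift (d : dir) : int := if d is DR then 1 else -1.

(* Triples up to blank padding do not record where the head is on the tape.
   To speak of the start cell, we run the machine on pairs (c, z), where z is
   the displacement of the head from the cell where it started. *)
Definition bv_pos_step (c : conf * int) : ell2 R (conf * int)%type :=
  \sum_x bv_delta M (state c.1, scanned c.1) x
         *: ket R (conf_step c.1 x, c.2 + shift x.2).

Definition bv_pos_evol : ell2 R (conf * int)%type -> ell2 R (conf * int)%type :=
  evolution bv_pos_step.

Definition bv_first_final (C : conf) (k : nat) : Prop :=
  (exists2 c, bv_final c & iter k bv_evol (ket R C) c != 0) /\
  (forall j, (j < k)%N -> forall c, bv_final c -> iter j bv_evol (ket R C) c = 0).

Record is_bvqtm : Prop := IsBVQTM {
  bv_q0_qf : bv_q0 M != bv_qf M;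
  bv_unitary : local_unitary predT predT predT (bv_delta M);
  bv_normal : forall a, bv_delta M (bv_qf M, a) (bv_q0 M, a, DR) = 1;
  bv_halting : forall C k, bv_initial C -> bv_first_final C k ->
    forall c, iter k bv_evol (ket R C) c != 0 -> bv_final c;
  bv_stationary : forall C k, bv_initial C -> bv_first_final C k ->
    forall c z, iter k bv_pos_evol (ket R (C, 0)) (c, z) != 0 -> z = 0 }.

Definition bv_halts_in (C : conf) (k : nat) : Prop :=
  bv_first_final C k /\
  forall c, iter k bv_evol (ket R C) c != 0 -> bv_final c.

Lemma bv_evolP : bounded_extension bv_step bv_evol.
Proof.
apply: evolutionP; apply: (@ex_bounded_extension _ _ _
  (fun (y : (Q * Sigma) * (Q * Sigma * dir)) (c : conf) =>
     if (state c, scanned c) == y.1 then Some (conf_step c y.2) else None)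
  (fun y => bv_delta M y.1 y.2)).
  move=> [s x] c c' j /=; case: eqP => // <- /Some_inj <-.
  by case: eqP => // -[e1 e2] /Some_inj/esym/conf_step_inj; apply.
move=> c; rewrite -(pair_bigA _ (fun s x => bv_delta M s x *: oapp (@ket R _) 0
  (if (state c, scanned c) == s then Some (conf_step c x) else None))) /=.
rewrite (bigD1 (state c, scanned c)) //= [X in _ + X]big1 ?addr0.
  by rewrite /bv_step; apply: eq_bigr => x _; rewrite eqxx.
by move=> s ns; rewrite big1 // => x _; rewrite eq_sym (negPf ns) scaler0.
Qed.

Lemma bv_pos_evolP : bounded_extension bv_pos_step bv_pos_evol.
Proof.
apply: evolutionP; apply: (@ex_bounded_extension _ _ _
  (fun (y : (Q * Sigma) * (Q * Sigma * dir)) (c : conf * int) =>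
     if (state c.1, scanned c.1) == y.1
     then Some (conf_step c.1 y.2, c.2 + shift y.2.2) else None)
  (fun y => bv_delta M y.1 y.2)).
  move=> [s x] [c z] [c' z'] j /=; case: eqP => // <- /Some_inj <-.
  case: eqP => // -[e1 e2] /Some_inj e; congr (_, _).
    by have /esym/conf_step_inj := congr1 fst e; apply.
  by have /addIr/esym := congr1 snd e.
move=> [c z]; rewrite -(pair_bigA _ (fun s x => bv_delta M s x *:
  oapp (@ket R _) 0 (if (state c, scanned c) == s
                     then Some (conf_step c x, z + shift x.2) else None))) /=.
rewrite (bigD1 (state c, scanned c)) //= [X in _ + X]big1 ?addr0.
  by rewrite /bv_pos_step; apply: eq_bigr => x _; rewrite eqxx.
by move=> s ns; rewrite big1 // => x _; rewrite eq_sym (negPf ns) scaler0.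
Qed.

End BV.

Section QTM.
Variables (R : realType) (Sigma : finType) (blank : Sigma) (Q : finType).

(* [inl a] is the symbol a and [inr a] the extra symbol \bar a. *)
Definition tilde : finType := (Sigma + Sigma)%type.
Local Notation tconf := (@conf tilde (inl blank) Q).

Definition plain : {pred tilde} :=
  [pred u : tilde | if u is inl _ then true else false].

(* [qdelta] is the union of delta_0, delta_s and delta_t, where an element of
   ell^2(T_x * {L, R}) is a function vanishing outside T_x * {L, R}; the values
   of [qdelta] outside of S_0, S_s and S_t are irrelevant. *)
Record qtm_data := QTMData {
  Qs : {set Q};
  Qt : {set Q};
  qdelta : Q * tilde -> Q * tilde * dir -> R[i];
  q_i : Q;
  q_f : Q }.

Variable M : qtm_data.

Definition Q0 : {pred Q} := [pred q | (q \notin Qs M) && (q \notin Qt M)].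

Definition S0 : {pred Q * tilde} :=
  [pred s | ((s.1 \in Q0) || (s.1 \in Qs M)) && (s.2 \in plain)].

Definition P0 : {pred Q} := [pred p | (p \in Q0) || (p \in Qt M)].

(* [qtm_support0] says that delta_0 takes its values in ell^2(T_0 * {L, R})
   with T_0 = P0 * Sigma. *)
Record is_qtm : Prop := IsQTM {
  qtm_disjoint : forall q, q \in Qs M -> q \notin Qt M;
  qtm_qi : q_i M \in Qs M;
  qtm_qf : q_f M \in Qt M;
  qtm_support0 : forall s x, s \in S0 ->
    ~~ ((x.1.1 \in P0) && (x.1.2 \in plain)) -> qdelta M s x = 0;
  qtm_unitary : local_unitary S0 P0 plain (qdelta M);
  qtm_source : forall q a x, q \in Qs M ->
    qdelta M (q, inr a) x = (x == (q, inl a, DR))%:R;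
  qtm_target : forall q a x, q \in Qt M ->
    qdelta M (q, inl a) x = (x == (q, inr a, DR))%:R }.

Definition is_qconf (c : tconf) : Prop :=
  [/\ state c \in Q0 -> exists s, c.1.1 ++ c.2 = map inl s,
      state c \in Qs M -> (exists s, c.1.1 = map inl s) /\
        (exists r s, c.2 = map inr r ++ map inl s)
    & state c \in Qt M -> (exists s, c.2 = map inl s) /\
        (exists r s, c.1.1 = map inl r ++ map inr s)].

Record qconf := QConf { qconf_val :> tconf; _ : `[< is_qconf qconf_val >] }.

HB.instance Definition _ := [isSub for qconf_val].
HB.instance Definition _ := [Countable of qconf by <:].

(* No nonzero term is lost through [insub], see [is_qconf_step]. *)
Definition qtm_step (c : qconf) : ell2 R qconf :=
  \sum_x qdelta M (state c, scanned c) x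
         *: oapp (@ket R qconf) 0 (insub (conf_step c x)).

Definition qtm_evol : ell2 R qconf -> ell2 R qconf := evolution qtm_step.

Lemma qtm_evolP : bounded_extension qtm_step qtm_evol.
Proof.
apply: evolutionP; apply: (@ex_bounded_extension _ _ _
  (fun (y : (Q * tilde) * (Q * tilde * dir)) (c : qconf) =>
     if (state c, scanned c) == y.1 then insub (conf_step c y.2) else None)
  (fun y => qdelta M y.1 y.2)).
  move=> [s x] c c' j /=; case: eqP => // <-.
  case: insubP => // u _ eu [uj]; case: eqP => // -[e1 e2].
  case: insubP => // u' _ eu' [uj']; apply: val_inj.
  apply: (@conf_step_inj _ _ _ _ _ x) => //.
  by rewrite -eu -eu' uj uj'.
move=> c; rewrite -(pair_bigA _ (fun s x => qdelta M s x *: oapp (@ket R _) 0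
  (if (state c, scanned c) == s then insub (conf_step c x) else None))) /=.
rewrite (bigD1 (state c, scanned c)) //= [X in _ + X]big1 ?addr0.
  by rewrite /qtm_step; apply: eq_bigr => x _; rewrite eqxx.
by move=> s ns; rewrite big1 // => x _; rewrite eq_sym (negPf ns) scaler0.
Qed.

Lemma rstrip_map s :
  rstrip (inl blank : tilde) (map inl s) = map inl (rstrip blank s).
Proof.
elim: s => //= a s ->; rewrite (inj_eq inl_inj).
by case: (a == blank) => //=; case: (rstrip blank s).
Qed.

Lemma inl_conf_subproof (c : conf blank Q) :
  let t := (map inl c.1.1 : seq tilde, c.1.2, map inl c.2 : seq tilde) in
  strip (inl blank) t == t.
Proof.
case: c => [[[al q] be] /= /eqP]; rewrite /strip /= => -[e1 e2].
by rewrite /lstrip -map_rev !rstrip_map -map_rev -/(lstrip _ _) e1 e2.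
Qed.

Definition inl_conf (c : conf blank Q) : tconf := Conf (inl_conf_subproof c).

Lemma plain_is_qconf (c : tconf) r s :
  c.1.1 = map inl r -> c.2 = map inl s -> is_qconf c.
Proof.
move=> er es; split=> _.
- by exists (r ++ s); rewrite map_cat er es.
- by split; [exists r|exists [::], s].
- by split; [exists s|exists r, [::]; rewrite cats0].
Qed.

Lemma emb_subproof (c : conf blank Q) : `[< is_qconf (inl_conf c) >].
Proof. by apply/asboolP; exact: plain_is_qconf. Qed.

(* Every configuration of a B&V machine on Q is one of M, whatever its state:
   words over Sigma satisfy the conditions on the tape for all states. *)
Definition emb (c : conf blank Q) : qconf := QConf (emb_subproof c).

Lemma emb_inj : injective emb.
Proof.
move=> [[[al q] be] h] [[[al' q'] be'] h'] /(congr1 (val \o val)) /= [].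
move=> /(inj_map inl_inj) e1 e2 /(inj_map inl_inj) e3; apply: val_inj.
by rewrite /= e1 e2 e3.
Qed.

(* The inclusion of ell^2 spaces induced by [emb]. *)
Definition emb_ell2 : ell2 R (conf blank Q) -> ell2 R qconf :=
  push (fun c => Some (emb c)).

Lemma emb_ell2_ket c : emb_ell2 (ket R c) = ket R (emb c).
Proof.
rewrite /emb_ell2 push_ket // => i i' j /Some_inj <- /Some_inj/emb_inj.
exact: esym.
Qed.

Lemma rstrip_take (s : seq tilde) : exists n, rstrip (inl blank) s = take n s.
Proof.
have [n e] := rstrip_pad (inl blank) s.
by move: (rstrip _ s) e => r ->; exists (size r); rewrite take_size_cat.
Qed.

Lemma lstrip_drop (s : seq tilde) : exists n, lstrip (inl blank) s = drop n s.
Proof.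
have [n e] := rstrip_take (rev s).
by rewrite /lstrip e take_rev revK; exists (size s - n)%N.
Qed.

Lemma is_qconf_step (c : qconf) x : is_qtm ->
  qdelta M (state c, scanned c) x != 0 -> is_qconf (conf_step c x).
Proof.
move=> HM; case: c => -[[[al q] be] nc] /= /asboolP[].
rewrite /state /scanned /= => H0 Hs Ht dx.
have plain_case r s : al = map inl r -> be = map inl s ->
    (q \in Q0) || (q \in Qs M) -> is_qconf (conf_step (Conf nc) x).
  move=> er es Hq.
  have S0q : (q, head (inl blank) be) \in S0.
    by rewrite inE /= Hq es; case: (s).
  have /andP[] : (x.1.1 \in P0) && (x.1.2 \in plain).
    by apply: contraNT dx => /(qtm_support0 HM S0q) ->.
  case: x {dx} => [[p [b|b]] [|]] //= _ _; rewrite /conf_step /=.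
  - have [n1 e1] := lstrip_drop (take (size al).-1 al).
    have [n2 e2] := rstrip_take [:: last (inl blank) al, inl b & behead be].
    apply: (@plain_is_qconf _ (drop n1 (take (size al).-1 r))
      (take n2 [:: last blank r, b & behead s])).
      by rewrite /= e1 er map_drop map_take.
    by rewrite [LHS]e2 er es map_take /= last_map behead_map.
  - have [n1 e1] := lstrip_drop (rcons al (inl b)).
    have [n2 e2] := rstrip_take (behead be).
    apply: (@plain_is_qconf _ (drop n1 (rcons r b)) (take n2 (behead s))).
      by rewrite /= e1 er map_drop map_rcons.
    by rewrite /= e2 es map_take behead_map.
have [qt|nqt] := boolP (q \in Qt M).
  have [[s es] [r [r' er]]] := Ht qt.
  have [a ea] : exists a, head (inl blank : tilde) be = inl a.
    by rewrite es; case: (s) => [|a s'] /=; [exists blank|exists a].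
  move: dx; rewrite ea (qtm_target HM) //; case: (x =P _) => [->|]; last by rewrite eqxx.
  move=> _; rewrite /conf_step /is_qconf /state /=; split.
  - by rewrite inE qt andbF.
  - by move/(qtm_disjoint HM); rewrite qt.
  - move=> _; split.
      have [n ->] := rstrip_take (behead be).
      by exists (take n (behead s)); rewrite es map_take behead_map.
    have [n ->] := lstrip_drop (rcons al (inr a)).
    rewrite er rcons_cat -map_rcons drop_cat; case: ifP => _.
      by exists (drop n r), (rcons r' a); rewrite map_drop.
    by exists [::], (drop (n - size (map inl r : seq tilde)) (rcons r' a));
      rewrite map_drop.
have [qs|nqs] := boolP (q \in Qs M); last first.
  have q0 : q \in Q0 by rewrite inE nqs.
  have [w ew] := H0 q0.
  apply: (plain_case (take (size al) w) (drop (size al) w)); last by rewrite q0.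
    by rewrite map_take -ew take_size_cat.
  by rewrite map_drop -ew drop_size_cat.
have [[r er] [s [s' es]]] := Hs qs.
case: s es => [|a s] es.
  by apply: (plain_case r s'); rewrite ?qs ?orbT.
have ea : head (inl blank : tilde) be = inr a by rewrite es.
move: dx; rewrite ea (qtm_source HM) //; case: (x =P _) => [->|]; last by rewrite eqxx.
move=> _; rewrite /conf_step /is_qconf /state /=; split.
- by rewrite inE qs.
- move=> _; split.
    have [n ->] := lstrip_drop (rcons al (inl a)).
    by exists (drop n (rcons r a)); rewrite er map_drop map_rcons.
  have [n ->] := rstrip_take (behead be).
  rewrite es /= take_cat; case: ifP => _.
    by exists (take n s), [::]; rewrite map_take cats0.
  by exists s, (take (n - size (map inr s : seq tilde)) s'); rewrite map_take.
- by move/negP: nqt.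
Qed.

End QTM.

(* Main.v *)
Require Import Defs.
From mathcomp Require Import all_boot all_order all_algebra.
From mathcomp Require Import all_classical all_reals.
From mathcomp.real_closed Require Import complex.

(** Take [M'] with the same states, [Q_s = {q0}], [Q_t = {qf}] and [delta_0] the
    restriction of [delta] to the sources with state other than [qf].  Unitarity
    and [delta (qf, a) (q0, a, R) = 1] force every other transition into [q0] to
    have amplitude 0, so [delta_0] takes its values in [ell^2 (T_0 * {L, R})]
    and inherits the local unitary conditions.  Before [M] halts, its
    q-configuration is a finite superposition of non-final configurations, and
    on each of those the two machines make the same step. *)

Set Implicit Arguments.
Unset Strict Implicit.
Unset Printing Implicit Defensive.

Import GRing.Theory Num.Theory.

Local Open Scope ring_scope.

Lemma linear_comb (K : pzRingType) (V W : lmodType K) (U : V -> W) :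
  linear U -> forall (I : Type) (r : seq I) (a : I -> K) (v : I -> V),
  U (\sum_(i <- r) a i *: v i) = \sum_(i <- r) a i *: U (v i).
Proof.
move=> linU I r a v; elim: r => [|i r IH]; last by rewrite !big_cons linU IH.
(* Linearity at scalar [-1] and zero vectors gives [U 0 = - U 0 + U 0], which is the empty sum. *)
rewrite !big_nil; have := linU (-1) 0 0.
by rewrite scaler0 addr0 scaleN1r addNr.
Qed.

(** * Finitely supported vectors of [ell2] *)

Section FiniteSupport.
Variables (R : realType) (I : choiceType).
Implicit Types (psi phi : ell2 R I).

(** Such vectors are finite combinations of kets, so linearity alone, without continuity, determines
    the evolution on them. *)
Definition finitely_supported psi :=
  exists s : seq I, forall i, i \notin s -> psi i = 0.

Lemma ell2_sumE (J : Type) (r : seq J) (F : J -> ell2 R I) i :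
  (\sum_(j <- r) F j) i = \sum_(j <- r) F j i.
Proof.
by elim: r => [|j r IH]; rewrite ?big_nil // !big_cons -IH.
Qed.

Lemma finitely_supported_ket i : finitely_supported (ket R i).
Proof. by exists [:: i] => j; rewrite inE /= => /negPf ->. Qed.

Lemma finitely_supported_comb (J : Type) (r : seq J) (a : J -> R[i])
    (F : J -> ell2 R I) : (forall j, finitely_supported (F j)) ->
  finitely_supported (\sum_(j <- r) a j *: F j).
Proof.
move=> fF; elim: r => [|j r [s Hs]]; first by exists [::] => i _; rewrite big_nil.
have [t Ht] := fF j; exists (s ++ t) => i.
rewrite mem_cat negb_or big_cons => /andP[/Hs si /Ht ti].
rewrite [LHS](_ : _ = a j *: F j i + (\sum_(j <- r) a j *: F j) i) //.
by rewrite si ti scaler0 addr0.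
Qed.

Lemma finitely_supportedE psi : finitely_supported psi ->
  exists s : seq I, psi = \sum_(i <- s) psi i *: ket R i.
Proof.
(* Without [undup], a repeated entry of [s] would be counted several times. *)
move=> [s Hs]; exists (undup s); apply: val_inj; apply: funext => i /=.
rewrite ell2_sumE (eq_bigr (fun j => psi j * (i == j)%:R)) //.
have [si|nsi] := boolP (i \in s).
  rewrite (bigD1_seq i) ?mem_undup ?undup_uniq //= eqxx mulr1 big1 ?addr0 //.
  by move=> j; rewrite eq_sym => /negPf ->; rewrite mulr0.
rewrite Hs // big1_seq // => j /andP[_]; rewrite mem_undup => sj.
by case: eqP => [ij|]; rewrite ?mulr0 // ij sj in nsi *.
Qed.

End FiniteSupport.

(** * Supports and forced zero amplitudes of a B&V-QTM *)

Section BVSupport.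
Variables (R : realType) (Sigma : finType) (blank : Sigma) (Q : finType).
Variables (M : bv_data R Sigma Q).

Lemma bv_iter_finitely_supported (C : conf blank Q) k :
  finitely_supported (iter k (bv_evol M) (ket R C)).
Proof.
have [linU _ Uket] := bv_evolP blank M.
elim: k => [|k IH] /=; first exact: finitely_supported_ket.
have [s ->] := finitely_supportedE IH; rewrite (linear_comb linU).
apply: finitely_supported_comb => c; rewrite Uket.
by apply: finitely_supported_comb => x; exact: finitely_supported_ket.
Qed.

Hypothesis HM : is_bvqtm blank M.

(** The row has norm 1, and the amplitude 1 of normal form exhausts it. *)
Lemma bv_delta_final a x :
  bv_delta M (bv_qf M, a) x = (x == (bv_q0 M, a, DR))%:R.
Proof.
case: eqP => [->|/eqP nx]; first exact: bv_normal HM a.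
have [norm1 _ _] := bv_unitary HM.
have := norm1 (bv_qf M, a) isT.
rewrite (bigD1 (bv_q0 M, a, DR)) //= (bv_normal HM) normr1 expr1n.
move=> /(canRL (addKr _)); rewrite addNr => sum0.
have /psumr_eq0P/(_ sum0 x nx)/eqP : forall y, y != (bv_q0 M, a, DR) ->
    0 <= `|bv_delta M (bv_qf M, a) y| ^+ 2 by move=> y _; rewrite exprn_ge0.
by rewrite sqrf_eq0 normr_eq0 => /eqP.
Qed.

(** As the row of [(qf, b)] is an indicator, its product with the row of [(q, a)] is a single
    amplitude. The third unitary condition kills [d = DL], orthogonality of rows kills [d = DR]. *)
Lemma bv_delta_into_initial q a b d : q != bv_qf M ->
  bv_delta M (q, a) (bv_q0 M, b, d) = 0.
Proof.
move=> nq; have [_ ortho sep] := bv_unitary HM; case: d; apply/eqP.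
  rewrite -conjC_eq0 -(sep (bv_qf M, b) (q, a) b b) // (bigD1 (bv_q0 M)) //=.
  rewrite bv_delta_final eqxx mulr1 big1 ?addr0 // => p np.
  by rewrite bv_delta_final !xpair_eqE (negPf np) mulr0.
rewrite -(ortho (q, a) (bv_qf M, b)) ?xpair_eqE ?(negPf nq) //.
rewrite (bigD1 (bv_q0 M, b, DR)) //= bv_delta_final eqxx conjC1 mul1r.
rewrite big1 ?addr0 // => x nx.
by rewrite bv_delta_final (negPf nx) conjC0 mul0r.
Qed.

End BVSupport.

(** * The QTM built from [M] *)

Section Construction.
Variables (R : realType) (Sigma : finType) (blank : Sigma) (Q : finType).
Variables (M : bv_data R Sigma Q).
Local Notation tilde := (tilde Sigma).

Definition inl_move (x : Q * Sigma * dir) : Q * tilde * dir :=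
  (x.1.1, inl x.1.2, x.2).

(** The partial inverse of [inl_move], in the form that [reindex_omap] takes. *)
Definition plain_move (x : Q * tilde * dir) : option (Q * Sigma * dir) :=
  if x.1.2 is inl b then Some (x.1.1, b, x.2) else None.

Lemma big_plain_move (V : nmodType) (P : pred (Q * tilde * dir))
    (F : Q * tilde * dir -> V) : (forall x, P x -> x.1.2 \in @plain Sigma) ->
  \sum_(x | P x) F x = \sum_(y | P (inl_move y)) F (inl_move y).
Proof.
move=> Pplain; rewrite (reindex_omap inl_move plain_move).
  by apply: eq_bigl => -[[p b] d]; rewrite /plain_move /= eqxx andbT.
by case=> [[p [b|b]] d] // /Pplain.
Qed.

Definition qtm_of_bv : qtm_data R Sigma Q := {|
  Qs := [set bv_q0 M];
  Qt := [set bv_qf M];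
  qdelta s x := match s.2 with
    | inr a => (x == (s.1, inl a, DR))%:R
    | inl a =>
      if s.1 == bv_qf M then (x == (s.1, inr a, DR))%:R
      else oapp (bv_delta M (s.1, a)) 0 (plain_move x)
    end;
  q_i := bv_q0 M;
  q_f := bv_qf M |}.

Hypothesis HM : is_bvqtm blank M.
Local Notation M' := qtm_of_bv.

Lemma P0_qtm_of_bv p : (p \in P0 M') = (p != bv_q0 M).
Proof.
rewrite !inE; case: eqP => [->|_] /=; first by rewrite (negPf (bv_q0_qf HM)).
by rewrite orNb.
Qed.

Lemma S0_qtm_of_bv q u : (q, u) \in S0 M' ->
  exists2 a, u = inl a & q != bv_qf M.
Proof.
case: u => [a|a]; rewrite inE /= ?andbF // => /andP[q0 _]; exists a => //.
by apply: contraTneq q0 => ->; rewrite !inE eqxx andbF eq_sym (negPf (bv_q0_qf HM)).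
Qed.

Lemma qdelta_inl_move q a y : q != bv_qf M ->
  qdelta M' (q, inl a) (inl_move y) = bv_delta M (q, a) y.
Proof. by move=> /negPf /= ->; case: y => [[p b] d]. Qed.

(** Brings the sums of the first two unitary conditions back to [M]: the targets left out are those
    into [q0], whose terms vanish. *)
Lemma sum_qdelta (F : Q * Sigma * dir -> R[i])
    (G : Q * tilde * dir -> R[i]) :
  (forall y, G (inl_move y) = F y) ->
  (forall b d, F (bv_q0 M, b, d) = 0) ->
  \sum_(x | (x.1.1 \in P0 M') && (x.1.2 \in @plain Sigma)) G x = \sum_y F y.
Proof.
move=> GF F0; rewrite big_plain_move => [|x /andP[]//].
rewrite big_rmcond => [|[[p b] d]]; first exact: eq_bigr.
by rewrite P0_qtm_of_bv andbT negbK GF => /eqP /= ->.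
Qed.

Lemma qtm_of_bv_unitary : local_unitary (S0 M') (P0 M') (@plain Sigma) (qdelta M').
Proof.
have [norm1 ortho sep] := bv_unitary HM.
split.
- move=> [q u] /S0_qtm_of_bv[a -> nq].
  rewrite (@sum_qdelta (fun y => `|bv_delta M (q, a) y| ^+ 2)).
  + exact: (norm1 (q, a) isT).
  + by move=> y; rewrite qdelta_inl_move.
  + by move=> b d; rewrite (bv_delta_into_initial HM) // normr0 expr0n.
- move=> [q u] [q' u'] /S0_qtm_of_bv[a -> nq] /S0_qtm_of_bv[a' -> nq'] ns.
  rewrite (@sum_qdelta (fun y => (bv_delta M (q', a') y)^* * bv_delta M (q, a) y)).
  + by apply: (ortho (q, a) (q', a') isT isT); apply: contraNneq ns => -[-> ->].
  + by move=> y; rewrite !qdelta_inl_move.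
  + by move=> b d; rewrite (bv_delta_into_initial HM a b d nq) mulr0.
- move=> [q u] [q' u'] [b|//] [b'|//].
  move=> /S0_qtm_of_bv[a -> nq] /S0_qtm_of_bv[a' -> nq'] _ _.
  rewrite /= (negPf nq) (negPf nq') /=.
  rewrite -[RHS](sep (q, a) (q', a') b b' isT isT isT isT).
  (* Here the sum is over states; again the only missing term, at [q0], is 0. *)
  rewrite [LHS]big_rmcond => // p.
  rewrite P0_qtm_of_bv negbK => /eqP ->.
  by rewrite (bv_delta_into_initial HM a b DR nq) mulr0.
Qed.

Lemma qtm_of_bvP : is_qtm M'.
Proof.
split.
- by move=> q; rewrite !inE => /eqP ->; exact: bv_q0_qf HM.
- by rewrite inE.
- by rewrite inE.
- move=> [q u] [[p v] d] /S0_qtm_of_bv[a -> nq].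
  rewrite /= (negPf nq) P0_qtm_of_bv; case: v => [b|b] //=.
  by rewrite andbT negbK => /eqP ->; rewrite (bv_delta_into_initial HM a b d nq).
- exact: qtm_of_bv_unitary.
- by [].
- by move=> q a x; rewrite inE /= => ->.
Qed.

(** * Comparison of the two evolutions *)

Lemma mkconf_inl (al be : seq Sigma) (q : Q) :
  mkconf (inl blank : tilde) (map inl al, q, map inl be)
  = inl_conf (mkconf blank (al, q, be)).
Proof.
by apply: val_inj; rewrite /= /strip /lstrip /= -map_rev !rstrip_map -map_rev.
Qed.

Lemma conf_step_inl (c : conf blank Q) y :
  conf_step (inl_conf c) (inl_move y) = inl_conf (conf_step c y).
Proof.
case: c y => [[[al q] be] nc] [[p v] [|]]; rewrite /conf_step -mkconf_inl /=.
  by rewrite size_map last_map behead_map map_take.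
by rewrite behead_map map_rcons.
Qed.

Lemma qtm_step_emb (c : conf blank Q) : state c != bv_qf M ->
  qtm_step (emb M' c) = emb_ell2 M' (bv_step M c).
Proof.
move=> nf; rewrite /emb_ell2 /bv_step (linear_comb (@push_linear _ _ _ _)).
have sc : scanned (emb M' c) = inl (scanned c).
  (* On an empty right part both heads read the default, and [inl blank] is the blank of [tilde]. *)
  by rewrite /scanned /=; case: (c : seq _ * _ * seq _) => [? [|]].
rewrite /qtm_step sc (bigID (fun x => x.1.2 \in @plain Sigma)) /=.
rewrite [X in _ + X]big1 ?addr0; last first.
  by case=> [[p [b|b]] d] //= _; rewrite (negPf nf) scale0r.
rewrite big_plain_move //; apply: eq_bigr => y _.
rewrite (negPf nf) -/(emb_ell2 M' _) emb_ell2_ket.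
(* The target is in the image of [emb], so [insub] drops no term. *)
rewrite conf_step_inl (valK (emb M' (conf_step c y))).
by case: y => [[p b] d].
Qed.

Lemma qtm_iter_emb (C : conf blank Q) k :
  (forall j, (j < k)%N -> forall c, bv_final M c ->
     iter j (bv_evol M) (ket R C) c = 0) ->
  iter k (@qtm_evol R Sigma blank Q M') (ket R (emb M' C))
  = emb_ell2 M' (iter k (bv_evol M) (ket R C)).
Proof.
have [linU _ Uket] := bv_evolP blank M.
have [linU' _ Uket'] := qtm_evolP blank M'.
have linE : linear (@emb_ell2 R Sigma blank Q M') by exact: push_linear.
elim: k => [|k IH] nf /=; first by rewrite emb_ell2_ket.
rewrite IH => [|j jk]; last by apply: nf; exact: leqW.
(* Only the source [psi] of the step must avoid final configurations; its image at time [k.+1] may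
   be final. *)
have := nf k (ltnSn k); set psi := iter k _ _ => nfpsi.
have [s ->] : exists s : seq (conf blank Q), psi = \sum_(c <- s) psi c *: ket R c.
  exact/finitely_supportedE/bv_iter_finitely_supported.
rewrite (linear_comb linE) (linear_comb linU) (linear_comb linU').
rewrite (linear_comb linE); apply: eq_bigr => c _.
(* On final configurations the two steps differ, but there [psi] is 0. *)
rewrite emb_ell2_ket Uket Uket'; have [fc|nfc] := eqVneq (state c) (bv_qf M).
  by rewrite nfpsi // !scale0r.
by rewrite qtm_step_emb.
Qed.

End Construction.

Theorem mainTheorem4 (R : realType) (Sigma : finType) (one blank : Sigma)
    (one_blank : one != blank) (Q : finType) (M : bv_data R Sigma Q)
    (HM : is_bvqtm blank M) :
  exists M' : qtm_data R Sigma Q,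
    [/\ is_qtm M', bv_q0 M \in Qs M', bv_qf M \in Qt M'
      & forall (C : conf blank Q) (k : nat),
          bv_initial M C -> bv_halts_in M C k ->
          iter k (@qtm_evol R Sigma blank Q M') (ket R (emb M' C))
          = emb_ell2 M' (iter k (bv_evol M) (ket R C))].
Proof.
exists (qtm_of_bv M); split; rewrite ?inE //; first exact: qtm_of_bvP HM.
by move=> C k _ [[_ nf] _]; exact: qtm_iter_emb.
Qed.
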